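(* For every measurable space $X$, the measurable cone $\mathcal{M}(X)$ of finite non-negative measures on $X$ is integrable.
   Context: Cones. A precone is a module $P$ over the semiring $\mathbb{R}_{\ge 0}$ such that $x_1+x=x_2+x\Rightarrow x_1=x_2$ and $x_1+x_2=0\Rightarrow x_1=0$; it is partially ordered by $x\le y$ iff $y=x+z$ for some $z\in P$. A cone is a precone with a map $\|\cdot\|:P\to\mathbb{R}_{\ge0}$ such that $\|\lambda x\|=\lambda\|x\|$, $\|x\|=0\Rightarrow x=0$, $\|x+y\|\le\|x\|+\|y\|$, $\|x\|\le\|x+y\|$, and every increasing sequence in the unit ball $\mathcal{B}P=\{x\in P:\|x\|\le 1\}$ has a least upper bound in $P$, which lies in $\mathcal{B}P$. $P'$ denotes the cone of linear maps $P\to\mathbb{R}_{\ge0}$ that are monotone and preserve lubs of bounded increasing sequences, with norm $\|x'\|=\sup_{x\in\mathcal{B}P}x'(x)$. Measurability. Fix a small full subcategory $\mathbf{Ar}$ of the category of measurable spaces and measurable maps, closed under binary products, containing the one-point space $0$, all of whose objects are non-empty. A measurability structure on a cone $P$ is a family $(\mathcal{M}_Y)_{Y\in\mathbf{Ar}}$, where $\mathcal{M}_Y$ is a set of functions $m:Y\times P\to\mathbb{R}_{\ge0}$ with $m(s,\cdot)\in P'$ for all $s$, such that: (i) for $x\in\mathcal{B}P$, $s\mapsto m(s,x)$ is measurable $Y\to[0,1]$; (ii) for $\phi\in\mathbf{Ar}(Y',Y)$ and $m\in\mathcal{M}_Y$, $(s',x)\mapsto m(\phi(s'),x)$ belongs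 to $\mathcal{M}_{Y'}$; (iii) if $m(x_1)=m(x_2)$ for all $m\in\mathcal{M}_0$ (viewed as elements of $P'$) then $x_1=x_2$; (iv) $\|x\|=\sup\{m(x)/\|m\|: m\in\mathcal{M}_0,\ m\neq 0\}$. A measurable cone is a cone with a measurability structure. A path of arity $Y\in\mathbf{Ar}$ in a measurable cone $C$ is a bounded map $\gamma:Y\to C$ such that for all $Z\in\mathbf{Ar}$ and $m\in\mathcal{M}_Z$, $(t,s)\mapsto m(t,\gamma(s))$ is measurable on $Z\times Y$. For a finite measure $\nu$ on $Y$, an integral of $\gamma$ over $\nu$ is an $x\in C$ with $m(x)=\int m(\gamma(s))\,\nu(ds)$ for all $m\in\mathcal{M}_0$. A measurable cone is integrable if every path of every arity $Y\in\mathbf{Ar}$ has an integral over every finite measure on $Y$. The measurable cone $\mathcal{M}(X)$: its elements are the finite non-negative measures on $X$, with pointwise operations, norm $\|\mu\|=\mu(X)$, and for each $Y\in\mathbf{Ar}$ the tests $\mathcal{M}_Y=\{(s,\mu)\mapsto\mu(U)\ :\ U \text{ a measurable subset of } X\}$. *)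

(* Defs.v *)
From HB Require Import structures.
From mathcomp Require Import all_boot all_order all_algebra.
From mathcomp Require Import all_classical all_reals all_analysis.
Import Order.TTheory GRing.Theory Num.Theory.
Import numFieldNormedType.Exports.

Set Implicit Arguments.
Unset Strict Implicit.
Unset Printing Implicit Defensive.

Local Open Scope classical_set_scope.
Local Open Scope ring_scope.

Section nonneg_semiring.
Context {R : realType}.
Local Notation nR := {nonneg R}.

Let nngD (x y : nR) : nR := (x%:num + y%:num)%:nng.
Let nngM (x y : nR) : nR := (x%:num * y%:num)%:nng.

Let nngDA : associative nngD.
Proof. by move=> x y z; apply: val_inj => /=; rewrite addrA. Qed.
Let nngDC : commutative nngD.
Proof. by move=> x y; apply: val_inj => /=; rewrite addrC. Qed.
Let nng0D : left_id (0%:nng : nR) nngD.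
Proof. by move=> x; apply: val_inj => /=; rewrite add0r. Qed.

HB.instance Definition _ := [Choice of nR by <:].
HB.instance Definition _ := GRing.isNmodule.Build nR nngDA nngDC nng0D.

Let nngMA : associative nngM.
Proof. by move=> x y z; apply: val_inj => /=; rewrite mulrA. Qed.
Let nngMC : commutative nngM.
Proof. by move=> x y; apply: val_inj => /=; rewrite mulrC. Qed.
Let nng1M : left_id (1%:nng : nR) nngM.
Proof. by move=> x; apply: val_inj => /=; rewrite mul1r. Qed.
Let nngMDl : left_distributive nngM +%R.
Proof. by move=> x y z; apply: val_inj => /=; rewrite mulrDl. Qed.
Let nng0M : left_zero 0 nngM.
Proof. by move=> x; apply: val_inj => /=; rewrite mul0r. Qed.

HB.instance Definition _ :=
  GRing.Nmodule_isComPzSemiRing.Build nR nngMA nngMC nng1M nngMDl nng0M.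

End nonneg_semiring.

Section nonneg_lemmas.
Context {R : realType}.
Implicit Types x y : {nonneg R}.
Lemma nngD_num x y : (x + y)%:num = x%:num + y%:num. Proof. by []. Qed.
Lemma nngM_num x y : (x * y)%:num = x%:num * y%:num. Proof. by []. Qed.
Lemma nng0_num : (0 : {nonneg R})%:num = 0. Proof. by []. Qed.
Lemma nng1_num : (1 : {nonneg R})%:num = 1. Proof. by []. Qed.
Lemma nng_sum_num (f : nat -> {nonneg R}) n :
  (\sum_(i < n) f i)%:num = \sum_(i < n) (f i)%:num.
Proof. by elim: n => [|n IH]; rewrite ?big_ord0// !big_ord_recr/= -IH. Qed.
End nonneg_lemmas.

Definition cone_le (R : realType) (P : lSemiModType {nonneg R}) (x y : P) : Prop :=
  exists z : P, y = x + z.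

Definition increasing T (le : T -> T -> Prop) (u : nat -> T) : Prop :=
  forall m n, (m <= n)%N -> le (u m) (u n).

Definition is_lub T (le : T -> T -> Prop) (u : nat -> T) (l : T) : Prop :=
  (forall n, le (u n) l) /\ (forall y, (forall n, le (u n) y) -> le l y).

HB.mixin Record isPrecone (R : realType) P of GRing.LSemiModule {nonneg R} P := {
  cone_addIr : forall x x1 x2 : P, x1 + x = x2 + x -> x1 = x2;
  cone_add_eq0 : forall x1 x2 : P, x1 + x2 = 0 -> x1 = 0
}.

#[short(type="preconeType")]
HB.structure Definition Precone (R : realType) :=
  { P of isPrecone R P & GRing.LSemiModule {nonneg R} P }.

HB.mixin Record Precone_isCone (R : realType) P of Precone R P := {
  cone_norm : P -> {nonneg R};
  cone_normZ : forall (l : {nonneg R}) (x : P),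
    cone_norm (l *: x) = l * cone_norm x;
  cone_norm_eq0 : forall x : P, cone_norm x = 0 -> x = 0;
  cone_normD : forall x y : P, cone_norm (x + y) <= cone_norm x + cone_norm y;
  cone_norm_le : forall x y : P, cone_norm x <= cone_norm (x + y);
  cone_complete : forall u : nat -> P,
    increasing (@cone_le R P) u -> (forall n, (cone_norm (u n))%:num <= 1) ->
    exists2 l : P, is_lub (@cone_le R P) u l & (cone_norm l)%:num <= 1
}.

#[short(type="coneType")]
HB.structure Definition Cone (R : realType) :=
  { P of Precone_isCone R P & Precone R P }.

Section dual.
Context {R : realType} {P : coneType R}.
Implicit Type f : P -> {nonneg R}.

Definition unit_ball : set P := [set x | (cone_norm x)%:num <= 1].

Definition is_dual f : Prop :=
  [/\ (forall x y, f (x + y) = f x + f y) /\ (forall l x, f (l *: x) = l * f x),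
      forall x y, cone_le x y -> f x <= f y &
      forall (u : nat -> P) (l : P), increasing (@cone_le R P) u ->
        (exists M, forall n, cone_norm (u n) <= M) ->
        is_lub (@cone_le R P) u l ->
        is_lub (fun a b : {nonneg R} => a <= b) (f \o u) (f l)].

(* The set is bounded above whenever [is_dual f], so the real-valued [sup] is the
   actual supremum; likewise in [tests_norm] below, where [sup set0 = 0] is the
   supremum of the empty set in R_{>= 0}. *)
Definition dual_norm f : R := sup [set (f x)%:num | x in unit_ball].

End dual.

Definition measurable_iso d1 (T1 : measurableType d1) d2 (T2 : measurableType d2)
    : Prop :=
  exists (f : T1 -> T2) (g : T2 -> T1),
    [/\ measurable_fun setT f, measurable_fun setT g, cancel f g & cancel g f].

(* A small full subcategory of measurable spaces is given by its family of
   objects, the morphisms being all the measurable maps.  The objects are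
   non-empty because a [measurableType] is pointed.  The one-point object and
   the binary products are required up to isomorphism only. *)
Record arityCategory := ArityCategory {
  arity :> Type;
  arity_display : arity -> measure_display;
  arity_space : forall Y : arity, measurableType (arity_display Y);
  arity0 : arity;
  arity0P : exists p, [set: arity_space arity0] = [set p];
  arity_prodP : forall Y Z : arity, exists W : arity,
    measurable_iso (arity_space W) (arity_space Y * arity_space Z)%type
}.

Coercion arity_space : arity >-> Measurable.type.

(* An arity-[Y] test is kept as a function [Y -> P -> R_{>= 0}]; the tests of the
   one-point arity are identified with the elements [m s] of the dual of [P],
   [s] being the unique point. *)
Definition point_tests (R : realType) (Ar : arityCategory) (P : Type)
    (M : forall Y : Ar, set (Y -> P -> {nonneg R})) : set (P -> {nonneg R}) :=
  [set f | exists2 m, M (arity0 Ar) m & exists s, f = m s].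

HB.mixin Record Cone_isMeasurable (R : realType) (Ar : arityCategory) C
    of Cone R C := {
  tests : forall Y : Ar, set (Y -> C -> {nonneg R});
  tests_dual : forall (Y : Ar) m, tests Y m -> forall s : Y, @is_dual R C (m s);
  tests_measurable : forall (Y : Ar) m, tests Y m ->
    forall x : C, (cone_norm x)%:num <= 1 ->
      measurable_fun setT (fun s : Y => (m s x)%:num) /\
      (forall s : Y, (m s x)%:num <= 1);
  tests_comp : forall (Y Y' : Ar) (phi : Y' -> Y) m,
    measurable_fun setT phi -> tests Y m -> tests Y' (fun s' => m (phi s'));
  tests_sep : forall x1 x2 : C,
    (forall f, point_tests tests f -> f x1 = f x2) -> x1 = x2;
  tests_norm : forall x : C,
    (cone_norm x)%:num =
      sup [set (f x)%:num / dual_norm f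
          | f in [set f | point_tests tests f /\ f <> (fun=> 0)]]
}.

#[short(type="measurableConeType")]
HB.structure Definition MeasurableCone (R : realType) (Ar : arityCategory) :=
  { C of Cone_isMeasurable R Ar C & Cone R C }.

Section integrable.
Context {R : realType} {Ar : arityCategory} {C : measurableConeType R Ar}.

Definition is_path (Y : Ar) (gamma : Y -> C) : Prop :=
  (exists M, forall s, cone_norm (gamma s) <= M) /\
  (forall (Z : Ar) m, tests Z m ->
    measurable_fun setT (fun ts : Z * Y => (m ts.1 (gamma ts.2))%:num)).

Definition is_path_integral (Y : Ar) (gamma : Y -> C)
    (nu : {finite_measure set Y -> \bar R}) (x : C) : Prop :=
  forall f, point_tests (@tests R Ar C) f ->
    ((f x)%:num)%:E = (\int[nu]_(s in setT) ((f (gamma s))%:num)%:E)%E.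

End integrable.

Definition integrable_cone (R : realType) (Ar : arityCategory)
    (C : measurableConeType R Ar) : Prop :=
  forall (Y : Ar) (gamma : Y -> C), is_path gamma ->
  forall nu : {finite_measure set Y -> \bar R},
  exists x : C, is_path_integral gamma nu x.

(* A [measurableType] is pointed, which would exclude the empty space. *)
Record measurableSpace := MeasurableSpace {
  ms_carrier :> Type;
  ms_measurable : set (set ms_carrier);
  ms_sigma_algebra : sigma_algebra setT ms_measurable
}.

(* [fm_nonmeas] makes the total function representing a measure unique, so that
   equal measures are Leibniz-equal. *)
Record finiteMeasure (R : realType) (X : measurableSpace) := FiniteMeasure {
  fm_fun :> set X -> {nonneg R};
  fm_set0 : fm_fun set0 = 0;
  fm_sigma_additive : forall F : nat -> set X,
    (forall n, ms_measurable (F n)) -> trivIset setT F ->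
    (fun n => \sum_(i < n) (fm_fun (F i))%:num) @ \oo -->
      (fm_fun (\bigcup_n F n))%:num;
  fm_nonmeas : forall U, ~ ms_measurable U -> fm_fun U = 0
}.

Arguments fm_sigma_additive {R X} _ [F].
Arguments fm_set0 {R X} _.
Arguments fm_nonmeas {R X} _ [U].

Section finite_measure_module.
Context {R : realType} {X : measurableSpace}.
Local Notation FM := (finiteMeasure R X).
Local Notation msX := (@ms_measurable X).

Lemma fm_eq (m1 m2 : FM) : (forall U, msX U -> m1 U = m2 U) -> m1 = m2.
Proof.
move=> e; have {e} : fm_fun m1 = fm_fun m2.
  apply/funext => U; have [/e//|nU] := pselect (msX U).
  by rewrite !fm_nonmeas.
case: m1 m2 => [f1 a1 b1 c1] [f2 a2 b2 c2] /= e; subst f2.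
by congr FiniteMeasure; exact: Prop_irrelevance.
Qed.

Lemma ms0 : msX set0. Proof. by case: (ms_sigma_algebra X). Qed.
Lemma msD U : msX U -> msX (setT `\` U).
Proof. by case: (ms_sigma_algebra X) => _ + _; exact. Qed.
Lemma msT : msX setT. Proof. by rewrite -(setD0 setT); apply: msD; exact: ms0. Qed.

Lemma fm_additive (m : FM) U V : msX U -> msX V -> U `&` V = set0 ->
  (m (U `|` V))%:num = (m U)%:num + (m V)%:num.
Proof.
move=> mU mV UV0; rewrite -bigcup2E.
have mF n : msX (bigcup2 U V n) by case: n => [|[|n]] //=; exact: ms0.
have tF : trivIset setT (bigcup2 U V).
  apply/trivIsetP => -[|[|i]] [|[|j]] _ _ //= _; rewrite ?set0I ?setI0//.
  by rewrite setIC.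
have c := fm_sigma_additive m mF tF.
apply/(cvg_unique _ c) => //; apply: cvg_near_cst.
exists 2%N => // n /= n2; rewrite -(subnKC n2).
elim: (n - 2)%N => [|k IH].
  by rewrite addn0 !big_ord_recr big_ord0/= add0r.
by rewrite addnS big_ord_recr/= fm_set0 addr0.
Qed.

Lemma fm_mono (m : FM) U : (m U)%:num <= (m setT)%:num.
Proof.
have [mU|nU] := pselect (msX U); last first.
  by rewrite (fm_nonmeas _ nU) nng0_num.
rewrite -(setDUK (@subsetT _ U)) fm_additive//; last by rewrite setDIK.
  by rewrite lerDl.
exact: msD.
Qed.

Program Definition fm_zero : FM := @FiniteMeasure R X (fun=> 0) _ _ _.
Next Obligation. by []. Qed.
Next Obligation.
move=> F _ _ /=; rewrite (_ : (fun n => _) = (fun=> 0)); first exact: cvg_cst.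
by apply/funext => n; rewrite big1.
Qed.
Next Obligation. by []. Qed.

Program Definition fm_add (m1 m2 : FM) : FM :=
  @FiniteMeasure R X (fun U => m1 U + m2 U) _ _ _.
Next Obligation. by move=> m1 m2 /=; rewrite !fm_set0 addr0. Qed.
Next Obligation.
move=> m1 m2 F mF tF /=; under eq_fun do rewrite big_split/=.
by apply: cvgD; exact: fm_sigma_additive.
Qed.
Next Obligation. by move=> m1 m2 U nU /=; rewrite !fm_nonmeas// addr0. Qed.

Program Definition fm_scale (l : {nonneg R}) (m : FM) : FM :=
  @FiniteMeasure R X (fun U => l * m U) _ _ _.
Next Obligation. by move=> l m /=; rewrite fm_set0 mulr0. Qed.
Next Obligation.
move=> l m F mF tF /=; under eq_fun do rewrite -mulr_sumr.
by apply: cvgMr; exact: fm_sigma_additive.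
Qed.
Next Obligation. by move=> l m U nU /=; rewrite fm_nonmeas// mulr0. Qed.

HB.instance Definition _ := gen_eqMixin FM.
HB.instance Definition _ := gen_choiceMixin FM.

Let fm_addA : associative fm_add.
Proof. by move=> m1 m2 m3; apply: fm_eq => U _ /=; rewrite addrA. Qed.
Let fm_addC : commutative fm_add.
Proof. by move=> m1 m2; apply: fm_eq => U _ /=; rewrite addrC. Qed.
Let fm_add0 : left_id fm_zero fm_add.
Proof. by move=> m; apply: fm_eq => U _ /=; rewrite add0r. Qed.

HB.instance Definition _ := GRing.isNmodule.Build FM fm_addA fm_addC fm_add0.

Let fm_scaleA a b m : fm_scale a (fm_scale b m) = fm_scale (a * b) m.
Proof. by apply: fm_eq => U _ /=; rewrite mulrA. Qed.
Let fm_scale0 m : fm_scale 0 m = 0.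
Proof. by apply: fm_eq => U _ /=; rewrite mul0r. Qed.
Let fm_scale1 : left_id 1 fm_scale.
Proof. by move=> m; apply: fm_eq => U _ /=; rewrite mul1r. Qed.
Let fm_scaleDr : right_distributive fm_scale +%R.
Proof. by move=> l m1 m2; apply: fm_eq => U _ /=; rewrite mulrDr. Qed.
Let fm_scaleDl m : {morph fm_scale^~ m : a b / a + b}.
Proof. by move=> a b; apply: fm_eq => U _ /=; rewrite mulrDl. Qed.

HB.instance Definition _ := GRing.Nmodule_isLSemiModule.Build {nonneg R} FM
  fm_scaleA fm_scale0 fm_scale1 fm_scaleDr fm_scaleDl.

Lemma fm_addE (m1 m2 : FM) U : (m1 + m2) U = m1 U + m2 U. Proof. by []. Qed.
Lemma fm_zeroE U : (0 : FM) U = 0. Proof. by []. Qed.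
Lemma fm_scaleE l (m : FM) U : (l *: m) U = l * m U. Proof. by []. Qed.

Let fm_addIr (x x1 x2 : FM) : x1 + x = x2 + x -> x1 = x2.
Proof.
move=> e; apply: fm_eq => U _; apply: val_inj => /=.
have := congr1 (fun m : FM => (m U)%:num) e.
by rewrite !fm_addE !nngD_num => /addIr.
Qed.

Let fm_add_eq0 (x1 x2 : FM) : x1 + x2 = 0 -> x1 = 0.
Proof.
move=> e; apply: fm_eq => U _; apply: val_inj => /=.
have := congr1 (fun m : FM => (m U)%:num) e.
by rewrite fm_addE nngD_num => /eqP; rewrite paddr_eq0// => /andP[/eqP].
Qed.

HB.instance Definition _ := isPrecone.Build R FM fm_addIr fm_add_eq0.

Lemma fm_leP (m1 m2 : FM) :
  cone_le m1 m2 <-> forall U, (m1 U)%:num <= (m2 U)%:num.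
Proof.
split=> [[z ->] U|h]; first by rewrite fm_addE nngD_num lerDl.
have h0 U : 0 <= (m2 U)%:num - (m1 U)%:num by rewrite subr_ge0.
have d0 : NngNum (h0 set0) = 0.
  by apply: val_inj => /=; rewrite !fm_set0/= subrr.
have ds (F : nat -> set X) : (forall n, msX (F n)) -> trivIset setT F ->
    (fun n => \sum_(i < n) (NngNum (h0 (F i)))%:num) @ \oo -->
      (NngNum (h0 (\bigcup_n F n)))%:num.
  move=> mF tF /=; under eq_fun do rewrite sumrB.
  by apply: cvgB; exact: fm_sigma_additive.
have dn U : ~ msX U -> NngNum (h0 U) = 0.
  by move=> nU; apply: val_inj => /=; rewrite !fm_nonmeas//= subrr.
exists (FiniteMeasure d0 ds dn); apply: fm_eq => U _.
by apply: val_inj; rewrite /= addrC subrK.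
Qed.

Lemma fm_partial_sum_le (m : FM) (F : nat -> set X) :
  (forall n, msX (F n)) -> trivIset setT F ->
  forall n, \sum_(i < n) (m (F i))%:num <= (m (\bigcup_n F n))%:num.
Proof.
move=> mF tF n; have c := fm_sigma_additive m mF tF.
rewrite -(cvg_lim _ c)//.
apply: (@nondecreasing_cvgn_le _ (fun n => \sum_(i < n) (m (F i))%:num)).
  by apply/nondecreasing_seqP => k; rewrite big_ord_recr/= lerDl.
by apply/cvg_ex; eexists; exact: c.
Qed.

Lemma fm_limit (u : nat -> FM) (M : R) :
  (forall k n, (k <= n)%N -> forall U, (u k U)%:num <= (u n U)%:num) ->
  (forall n, (u n setT)%:num <= M) ->
  exists l : FM, forall U, (fun n => (u n U)%:num) @ \oo --> (l U)%:num.
Proof.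
move=> inc bnd; pose a U n := (u n U)%:num.
have nd U : nondecreasing_seq (a U) by move=> k n kn; exact: inc.
have ca U : cvgn (a U).
  apply: nondecreasing_is_cvgn => //; exists M => _ [n _ <-].
  exact: (le_trans (fm_mono _ _) (bnd n)).
have aL U n : a U n <= limn (a U) by apply: nondecreasing_cvgn_le.
have h0 U : 0 <= limn (a U) by apply: (le_trans _ (aL U 0%N)); rewrite /a.
have a_cst0 U : (forall n, u n U = 0) -> NngNum (h0 U) = 0.
  move=> e; apply: val_inj => /=; apply: cvg_lim => //.
  rewrite (_ : a U = fun=> 0); first exact: cvg_cst.
  by apply/funext => n; rewrite /a e.
have d0 : NngNum (h0 set0) = 0 by apply: a_cst0 => n; exact: fm_set0.
have dn U : ~ msX U -> NngNum (h0 U) = 0.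
  by move=> nU; apply: a_cst0 => n; exact: fm_nonmeas.
have ds (F : nat -> set X) : (forall n, msX (F n)) -> trivIset setT F ->
    (fun n => \sum_(i < n) (NngNum (h0 (F i)))%:num) @ \oo -->
      (NngNum (h0 (\bigcup_n F n)))%:num.
  move=> mF tF /=; set V := \bigcup_n F n.
  pose S N := \sum_(i < N) limn (a (F i)).
  have ndS : nondecreasing_seq S.
    by apply/nondecreasing_seqP => k; rewrite /S big_ord_recr/= lerDl.
  have SV N : S N <= limn (a V).
    have cS : (fun n => \sum_(i < N) a (F i) n) @ \oo --> S N.
      elim: N => [|N IH]; rewrite /S.
        by under eq_fun do rewrite big_ord0; rewrite big_ord0; exact: cvg_cst.
      under eq_fun do rewrite big_ord_recr/=; rewrite big_ord_recr/=.
      exact: (cvgD IH (ca _)).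
    rewrite -(cvg_lim _ cS)//; apply: limr_le; first by apply/cvg_ex; exists (S N).
    apply: nearW => n; apply: (le_trans _ (aL V n)).
    exact: fm_partial_sum_le.
  have cS : cvgn S.
    by apply: nondecreasing_is_cvgn => //; exists (limn (a V)) => _ [n _ <-].
  suff <- : limn S = limn (a V) by [].
  apply/eqP; rewrite eq_le; apply/andP; split.
    by apply: limr_le => //; exact: nearW.
  apply: limr_le => //; apply: nearW => n.
  have c := fm_sigma_additive (u n) mF tF.
  rewrite /a -(cvg_lim _ c)//; apply: ler_lim => //.
    by apply/cvg_ex; eexists; exact: c.
  by apply: nearW => N; apply: ler_sum => i _; exact: aL.
exists (FiniteMeasure d0 ds dn) => U; exact: ca.
Qed.

Lemma fm_limit_lub (u : nat -> FM) (l : FM) :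
  increasing (@cone_le R FM) u ->
  (forall U, (fun n => (u n U)%:num) @ \oo --> (l U)%:num) ->
  is_lub (@cone_le R FM) u l.
Proof.
move=> inc cl; split=> [n|y uy].
  apply/fm_leP => U; rewrite -(cvg_lim _ (cl U))//.
  apply: (@nondecreasing_cvgn_le _ (fun n => (u n U)%:num)).
    by move=> j k jk; exact: ((fm_leP _ _).1 (inc _ _ jk)).
  by apply/cvg_ex; eexists; exact: cl.
apply/fm_leP => U; rewrite -(cvg_lim _ (cl U))//; apply: limr_le.
  by apply/cvg_ex; eexists; exact: cl.
by apply: nearW => n; exact: ((fm_leP _ _).1 (uy n)).
Qed.

Definition fm_norm (m : FM) : {nonneg R} := m setT.

Let fm_normZ (l : {nonneg R}) (m : FM) : fm_norm (l *: m) = l * fm_norm m.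
Proof. by []. Qed.

Let fm_norm_eq0 (m : FM) : fm_norm m = 0 -> m = 0.
Proof.
move=> m0; apply: fm_eq => U _; apply: val_inj => /=.
apply/eqP; rewrite eq_le; apply/andP; split => //.
by apply: (le_trans (fm_mono m U)); rewrite -/(fm_norm m) m0.
Qed.

Let fm_normD (x y : FM) : fm_norm (x + y) <= fm_norm x + fm_norm y.
Proof. exact: lexx. Qed.

Let fm_norm_le (x y : FM) : fm_norm x <= fm_norm (x + y).
Proof. by rewrite -num_le/= /fm_norm nngD_num lerDl. Qed.

Let fm_complete (u : nat -> FM) :
  increasing (@cone_le R FM) u -> (forall n, (fm_norm (u n))%:num <= 1) ->
  exists2 l : FM, is_lub (@cone_le R FM) u l & (fm_norm l)%:num <= 1.
Proof.
move=> inc bnd.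
have inc' k n : (k <= n)%N -> forall U, (u k U)%:num <= (u n U)%:num.
  by move=> kn; apply/fm_leP/inc.
have [l cl] := fm_limit inc' bnd; exists l; first exact: fm_limit_lub.
rewrite /fm_norm -(cvg_lim _ (cl setT))//; apply: limr_le.
  by apply/cvg_ex; eexists; exact: cl.
exact: nearW.
Qed.

HB.instance Definition _ := Precone_isCone.Build R FM
  fm_normZ fm_norm_eq0 fm_normD fm_norm_le fm_complete.

End finite_measure_module.

Section dirac.
Context {R : realType} {X : measurableSpace} (p : X).

Let fm_dirac_fun (U : set X) : {nonneg R} :=
  if pselect (ms_measurable U /\ U p) then 1 else 0.

Let fm_dirac_in U : ms_measurable U -> U p -> fm_dirac_fun U = 1.
Proof. by move=> mU Up; rewrite /fm_dirac_fun; case: pselect => // -[]. Qed.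

Let fm_dirac_nin U : ~ (ms_measurable U /\ U p) -> fm_dirac_fun U = 0.
Proof. by move=> nU; rewrite /fm_dirac_fun; case: pselect. Qed.

Let fm_dirac_out U : ~ U p -> fm_dirac_fun U = 0.
Proof. by move=> nU; apply: fm_dirac_nin => -[_]; exact: nU. Qed.

Let fm_dirac_nonmeas U : ~ ms_measurable U -> fm_dirac_fun U = 0.
Proof. by move=> nU; apply: fm_dirac_nin => -[mU _]; exact: nU. Qed.

Let fm_dirac0 : fm_dirac_fun set0 = 0.
Proof. by apply: fm_dirac_out. Qed.

Let fm_dirac_sigma (F : nat -> set X) :
  (forall n, ms_measurable (F n)) -> trivIset setT F ->
  (fun n => \sum_(i < n) (fm_dirac_fun (F i))%:num) @ \oo -->
    (fm_dirac_fun (\bigcup_n F n))%:num.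
Proof.
move=> mF tF; have [[k _ Fk]|nF] := pselect ((\bigcup_n F n) p); last first.
  rewrite fm_dirac_out//.
  rewrite (_ : (fun n => _) = (fun=> 0)); first exact: cvg_cst.
  apply/funext => n; rewrite big1// => i _.
  by rewrite fm_dirac_out// => Fi; apply: nF; exists i.
have mV : ms_measurable (\bigcup_n F n).
  by case: (ms_sigma_algebra X) => _ _; exact.
rewrite (fm_dirac_in mV); last by exists k.
apply: cvg_near_cst; exists k.+1 => // n /= kn.
rewrite (bigD1 (Ordinal kn))//= (fm_dirac_in _ Fk)// big1 ?addr0// => i ik.
rewrite fm_dirac_out// => Fi; move/eqP: ik; apply; apply: val_inj => /=.
by apply: (tF i k) => //; exists p.
Qed.

Definition fm_dirac : finiteMeasure R X :=
  FiniteMeasure fm_dirac0 fm_dirac_sigma fm_dirac_nonmeas.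

Lemma fm_dirac1 U : ms_measurable U -> U p -> fm_dirac U = 1.
Proof. exact: fm_dirac_in. Qed.

End dirac.

Section finite_measure_measurable_cone.
Context {R : realType} {Ar : arityCategory} {X : measurableSpace}.
Local Notation FM := (finiteMeasure R X).

Definition fm_tests (Y : Ar) : set (Y -> FM -> {nonneg R}) :=
  [set m | exists2 U : set X, ms_measurable U & m = fun _ (mu : FM) => mu U].

Let fm_tests_dual (Y : Ar) m : fm_tests m -> forall s : Y, is_dual (m s).
Proof.
move=> [U mU ->] s; split=> //; first by move=> x y xy; exact: ((fm_leP _ _).1 xy).
move=> u l inc [M bnd] ulub; have inc' := inc.
have {}inc' k n : (k <= n)%N -> forall U, (u k U)%:num <= (u n U)%:num.
  by move=> kn; apply/fm_leP/inc.
have [l' cl] := @fm_limit R X u M%:num inc' bnd.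
have [ul' l'_least] := fm_limit_lub inc cl.
have {l'_least ul' ulub} -> : l = l'.
  have h1 := ulub.2 _ ul'; have h2 := l'_least _ ulub.1.
  apply: fm_eq => V _; apply/le_anti/andP; split; rewrite -num_le.
    exact: ((fm_leP _ _).1 h1).
  exact: ((fm_leP _ _).1 h2).
split=> [n|y uy] /=; rewrite -num_le/= -(cvg_lim _ (cl U))//.
  apply: (@nondecreasing_cvgn_le _ (fun n => (u n U)%:num)).
    by move=> j k jk; exact: inc'.
  by apply/cvg_ex; eexists; exact: cl.
apply: limr_le; first by apply/cvg_ex; eexists; exact: cl.
by apply: nearW => n; have := uy n; rewrite -num_le.
Qed.

Let fm_tests_measurable (Y : Ar) m : fm_tests m ->
  forall x : FM, (cone_norm x)%:num <= 1 ->
    measurable_fun setT (fun s : Y => (m s x)%:num) /\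
    (forall s : Y, (m s x)%:num <= 1).
Proof.
move=> [U mU ->] x x1; split=> [|s]; first exact: measurable_cst.
exact: (le_trans (fm_mono _ _) x1).
Qed.

Let fm_tests_comp (Y Y' : Ar) (phi : Y' -> Y) m :
  measurable_fun setT phi -> fm_tests m -> fm_tests (fun s' => m (phi s')).
Proof. by move=> _ [U mU ->]; exists U. Qed.

Lemma fm_point_testsE (f : FM -> {nonneg R}) : point_tests fm_tests f <->
  exists2 U : set X, ms_measurable U & f = fun mu : FM => mu U.
Proof.
split=> [[m [U mU ->] [s ->]]|[U mU ->]]; first by exists U.
by exists (fun _ (mu : FM) => mu U); [exists U|exists point].
Qed.

Let fm_tests_sep (x1 x2 : FM) :
  (forall f, point_tests fm_tests f -> f x1 = f x2) -> x1 = x2.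
Proof.
move=> h; apply: fm_eq => U mU.
by apply: (h (fun mu : FM => mu U)); apply/fm_point_testsE; exists U.
Qed.

Lemma fm_dual_norm (U : set X) (p : X) : ms_measurable U -> U p ->
  dual_norm (fun mu : FM => mu U) = 1.
Proof.
move=> mU Up; rewrite /dual_norm.
have ub : ubound [set (x U)%:num | x in @unit_ball R FM] 1.
  by move=> _ [m m1 <-]; exact: (le_trans (fm_mono _ _) m1).
have in1 : [set (x U)%:num | x in @unit_ball R FM] 1.
  exists (fm_dirac p); last by rewrite fm_dirac1.
  by rewrite /unit_ball/= [cone_norm _](fm_dirac1 (@msT X)).
apply/eqP; rewrite eq_le; apply/andP; split.
  by apply: ge_sup => //; exists 1.
by apply: ub_le_sup => //; exists 1.
Qed.

Let fm_tests_norm (x : FM) :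
  (cone_norm x)%:num =
    sup [set (f x)%:num / dual_norm f
        | f in [set f | point_tests fm_tests f /\ f <> (fun=> 0)]].
Proof.
set S := (X in sup X).
have Sub : ubound S (cone_norm x)%:num.
  move=> _ [f [/fm_point_testsE [U mU ->] nz] <-].
  have [[p Up]|U0] := pselect (exists p, U p).
    by rewrite (fm_dual_norm mU Up) divr1; exact: fm_mono.
  exfalso; apply: nz; apply/funext => m.
  rewrite (_ : U = set0) ?fm_set0//.
  by apply/seteqP; split=> // p Up; apply: U0; exists p.
have [[p _]|X0] := pselect (exists p : X, True).
  have Sx : S (cone_norm x)%:num.
    exists (fun mu : FM => mu setT).
      split; first by apply/fm_point_testsE; exists setT => //; exact: msT.
      move/(congr1 (fun g => (g (fm_dirac p))%:num)).
      rewrite (fm_dirac1 (@msT X))// => /eqP.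
      by rewrite nng1_num nng0_num oner_eq0.
    by rewrite (@fm_dual_norm _ p)// ?divr1//; exact: msT.
  apply/eqP; rewrite eq_le; apply/andP; split.
    by apply: ub_le_sup => //; eexists; exact: Sub.
  by apply: ge_sup => //; eexists; exact: Sx.
have T0 : [set: X] = set0.
  by apply/seteqP; split=> // q _; apply: X0; exists q.
have m0 (m : FM) U : m U = 0.
  rewrite (_ : U = set0) ?fm_set0//.
  by apply/seteqP; split=> // q _; apply: X0; exists q.
rewrite (_ : S = set0) ?sup0 ?[cone_norm _]m0//.
apply/seteqP; split=> // r [f [/fm_point_testsE [U mU ->] nz] _].
by apply: nz; apply/funext => m; exact: m0.
Qed.

HB.instance Definition _ := Cone_isMeasurable.Build R Ar FM
  fm_tests_dual fm_tests_measurable fm_tests_comp fm_tests_sep fm_tests_norm.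

End finite_measure_measurable_cone.

(* Main.v *)
(** The integral of a path [gamma] over [nu] is the measure
    U |-> \int gamma(s)(U) nu(ds); it is sigma-additive by monotone
    convergence, and finite because [gamma] and [nu] are bounded. *)
Require Import Defs.
From HB Require Import structures.
From mathcomp Require Import all_boot all_order all_algebra.
From mathcomp Require Import all_classical all_reals all_analysis.
From mathcomp Require Import measurable_realfun.
Import Order.TTheory GRing.Theory Num.Theory.
Import numFieldNormedType.Exports.

Local Open Scope classical_set_scope.
Local Open Scope ring_scope.

(** Tests on measures are just evaluations at measurable sets [U] ([fm_point_testsE]), so an
    integral of [gamma] is forced to be [U |-> \int gamma(s)(U) nu(ds)]. What remains is that this
    set function is an element of the cone: [path_measurable] makes the integrands measurable,
    [I_fin] bounds the values, [I_fun_sigma_additive] exchanges sum and integral. *)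

(* Measurability of a path is only postulated against tests with a parameter;
   instantiate it at the one-point arity and freeze the point. *)
Lemma path_measurable (R : realType) (Ar : arityCategory) (X : measurableSpace)
    (Y : Ar) (gamma : Y -> finiteMeasure R X) (U : set X) :
  @is_path R Ar _ Y gamma -> ms_measurable U ->
  measurable_fun setT (fun s => (gamma s U)%:num).
Proof.
move=> [_ mgamma] mU.
have mt : tests (arity0 Ar) (fun _ (mu : finiteMeasure R X) => mu U).
  by exists U.
exact: (measurableT_comp (mgamma _ _ mt) (pair1_measurable point)).
Qed.

Section integral_of_kernel.
Context {R : realType} {X : measurableSpace} {d} {Y : measurableType d}.
Variables (gamma : Y -> finiteMeasure R X)
  (nu : {finite_measure set Y -> \bar R}) (M : R).
Hypothesis mgamma : forall U, ms_measurable U ->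
  measurable_fun setT (fun s => (gamma s U)%:num).
Hypothesis gammaM : forall s, (gamma s setT)%:num <= M.

Let I (U : set X) : \bar R := (\int[nu]_s ((gamma s U)%:num)%:E)%E.

Let I_ge0 U : (0 <= I U)%E.
Proof. by apply: integral_ge0 => s _; rewrite lee_fin. Qed.

Let I_nonmeas U : ~ ms_measurable U -> I U = 0%E.
Proof.
by move=> nU; apply: integral0_eq => s _; rewrite fm_nonmeas.
Qed.

Let I_fin U : I U \is a fin_num.
Proof.
have [mU|/I_nonmeas -> //] := pselect (ms_measurable U).
rewrite ge0_fin_numE//; apply: (@le_lt_trans _ _ (\int[nu]_s (M%:E))%E).
  apply: ge0_le_integral => //.
  - exact/measurable_EFinP/mgamma.
  - by move=> s _; rewrite lee_fin (le_trans (fm_mono _ _) (gammaM s)).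
rewrite integral_cst// -ge0_fin_numE; first by rewrite fin_numM// fin_num_measure.
(* [0 <= M] follows from the bound at one point of [Y], which is pointed. *)
by rewrite mule_ge0// lee_fin (le_trans _ (gammaM point)).
Qed.

Let fine_I_ge0 U : 0 <= fine (I U).
Proof. exact: fine_ge0. Qed.

Let I_fun U : {nonneg R} := NngNum (fine_I_ge0 U).

Let I_fun0 : I_fun set0 = 0.
Proof.
apply: val_inj; rewrite /= [I _]integral0_eq// => s _.
by rewrite fm_set0.
Qed.

Let I_fun_nonmeas U : ~ ms_measurable U -> I_fun U = 0.
Proof. by move=> nU; apply: val_inj; rewrite /= I_nonmeas. Qed.

(** Monotone convergence for the partial sums [g n], which increase pointwise to
    [gamma s (\bigcup_n F n)] because each [gamma s] is sigma-additive. *)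
Let I_fun_sigma_additive (F : nat -> set X) :
  (forall n, ms_measurable (F n)) -> trivIset setT F ->
  (fun n => \sum_(i < n) (I_fun (F i))%:num) @ \oo -->
    (I_fun (\bigcup_n F n))%:num.
Proof.
move=> mF tF; pose g n s : \bar R := (\sum_(i < n) (gamma s (F i))%:num)%:E.
have intg n : (\int[nu]_s g n s = (\sum_(i < n) (I_fun (F i))%:num)%:E)%E.
  rewrite /g; under eq_integral do rewrite -sumEFin.
  rewrite ge0_integral_sum//; last first.
    by move=> i; exact/measurable_EFinP/mgamma.
  by rewrite -sumEFin; apply: eq_bigr => i _; rewrite /= fineK.
have mg n : measurable_fun setT (g n).
  apply/measurable_EFinP; apply: measurable_sum => i; exact: mgamma.
have limg s : limn (g^~ s) = ((gamma s (\bigcup_n F n))%:num)%:E.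
  apply: cvg_lim => //; apply: cvg_EFin; first exact: nearW.
  exact: fm_sigma_additive.
have := @cvg_monotone_convergence _ _ _ nu _ measurableT g mg.
have g0 n s : setT s -> (0 <= g n s)%E by rewrite lee_fin sumr_ge0.
have ndg s : setT s -> nondecreasing_seq (g^~ s).
  by move=> _; apply/nondecreasing_seqP => n; rewrite lee_fin big_ord_recr/= lerDl.
move=> /(_ g0 ndg); under eq_integral do rewrite limg.
under eq_fun do rewrite intg.
(* The limit is finite, so convergence in the extended reals descends to the reals. *)
rewrite -/(I _) -(fineK (I_fin _)).
exact: fine_cvg.
Qed.

Definition fm_integral : finiteMeasure R X :=
  Defs.FiniteMeasure I_fun0 I_fun_sigma_additive I_fun_nonmeas.

(** [fine] loses nothing here since [I U] is finite for every [U], measurable or not. *)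
Lemma fm_integralE U :
  ((fm_integral U)%:num)%:E = (\int[nu]_s ((gamma s U)%:num)%:E)%E.
Proof. exact: fineK. Qed.

End integral_of_kernel.

Theorem theorem4p5 (R : realType) (Ar : arityCategory) (X : measurableSpace) :
  @integrable_cone R Ar (finiteMeasure R X).
Proof.
move=> Y gamma pgamma nu; have [[M gammaM] _] := pgamma.
have mgamma U := @path_measurable R Ar X Y gamma U pgamma.
exists (fm_integral _ nu _ mgamma gammaM) => _ /fm_point_testsE [U mU ->].
exact: fm_integralE.
Qed.
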